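(* For every integer $k\ge 6$, $\Xi(k)\le 3k-9$.
   Context: All graphs are finite, simple and undirected. For a graph $G=(V,E)$ and $x\in V$, $N[x]=\{x\}\cup\{y: xy\in E\}$. A set $C\subseteq V$ is identifying if $N[x]\cap C\ne\emptyset$ for every $x\in V$ and $N[x]\cap C\neq N[y]\cap C$ for all distinct $x,y\in V$. For $n\ge k\ge1$, $\mathfrak{Gr}(n,k)$ is the set of graphs on $n$ vertices in which every $k$-element subset of vertices is identifying, and $\Xi(k)=\max\{n\ge k:\mathfrak{Gr}(n,k)\ne\emptyset\}$. *)

(* Defs.v *)
From mathcomp Require Import all_boot.

Set Implicit Arguments.
Unset Strict Implicit.
Unset Printing Implicit Defensive.

Record sgraph (T : finType) := SGraph {
  adj :> rel T;
  adj_sym : symmetric adj;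
  adj_irr : irreflexive adj
}.

Section Identifying.
Variables (T : finType) (G : sgraph T).

Definition closed_nbhd (x : T) : {set T} := x |: [set y | G x y].

Definition identifying (C : {set T}) : Prop :=
  (forall x : T, closed_nbhd x :&: C != set0) /\
  (forall x y : T, x != y -> closed_nbhd x :&: C != closed_nbhd y :&: C).

End Identifying.

(* The graphs on n vertices are taken with vertex set 'I_n, which loses
   nothing up to isomorphism. *)
Definition Gr (n k : nat) (G : sgraph 'I_n) : Prop :=
  forall C : {set 'I_n}, #|C| = k -> identifying G C.

Definition Gr_nonempty (n k : nat) : Prop := exists G : sgraph 'I_n, Gr k G.

(* A maximum of a set of integers need not exist a priori, so Xi(k) is given by
   its graph: is_Xi k m says that {n >= k : Gr(n, k) is nonempty} has a maximum
   and that this maximum is m. *)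
Definition is_Xi (k m : nat) : Prop :=
  [/\ k <= m, Gr_nonempty m k &
      forall n : nat, k <= n -> Gr_nonempty n k -> n <= m].

(* Main.v *)
Require Import Defs.
From mathcomp Require Import all_boot.
From mathcomp Require Import zify.
From Stdlib Require Import Classical_Prop.

(** The closed neighbourhoods in a graph of [Gr(n, k)], together with the empty
    set, form a binary code of length [n] with [n + 1] words and minimum distance
    at least [d = n - k + 1].  Because the matrix [A + I] is symmetric, its column
    sums are its row sums, and the averaging argument behind the Plotkin bound
    gives [n <= 2 k - 1].  In case of equality the graph is [(k - 1)]-regular with
    all distances equal to [k]: if [k] is odd the distances have the wrong parity,
    and if [k] is even the handshake lemma fails.  So [n <= 2 k - 2], which is
    enough unless [k = 6] and [n = 10].  There, words of weights of equal
    parity are at distance at least 6, and the averaging argument is tight again: a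
    set [S] of four vertices has closed neighbourhoods of size 6, the six others
    have size 5, and all pairwise intersection sizes are known.  Every vertex [t]
    outside [S] then has two neighbours in [S] and two neighbours [u], [v]
    outside [S]; both [N[u]] and [N[v]] contain [t] and the two elements of [S]
    not in [N[t]], but only two common elements are allowed. *)

Set Implicit Arguments.
Unset Strict Implicit.
Unset Printing Implicit Defensive.

(** * Finite sets, sums and maxima *)

Lemma subset_of_card (T : finType) (A : {set T}) (k : nat) :
  k <= #|A| -> exists2 C : {set T}, C \subset A & #|C| = k.
Proof.
move=> kA; exists [set x in take k (enum A)].
  by apply/subsetP=> x; rewrite inE => /mem_take; rewrite mem_enum.
rewrite cardsE (card_uniqP _) ?take_uniq ?enum_uniq //.
by rewrite size_takel // -cardE.
Qed.

Lemma leq_sum2 (I : finType) (f g : I -> I -> nat) :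
  (forall i j, f i j <= g i j) -> \sum_i \sum_j f i j <= \sum_i \sum_j g i j.
Proof. by move=> fg; apply: leq_sum => i _; apply: leq_sum. Qed.

(** Used where averaging is tight, to pass from equal sums to equal terms. *)
Lemma eq_of_leq_sum (I : finType) (f g : I -> nat) :
  (forall i, f i <= g i) -> \sum_i g i <= \sum_i f i -> f =1 g.
Proof.
move=> fg gf i; apply/eqP; rewrite eqn_leq fg /=.
move: gf; rewrite (bigD1 i) //= [X in _ <= X](bigD1 i) //= => gf.
have le : \sum_(j | j != i) f j <= \sum_(j | j != i) g j by apply: leq_sum.
lia.
Qed.

Lemma eq_of_leq_sum2 (I : finType) (f g : I -> I -> nat) :
  (forall i j, f i j <= g i j) ->
  \sum_i \sum_j g i j <= \sum_i \sum_j f i j -> forall i j, f i j = g i j.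
Proof.
move=> fg; rewrite !pair_bigA => gf i j.
exact: (eq_of_leq_sum (f := fun p => f p.1 p.2) (g := fun p => g p.1 p.2)
  (fun p => fg p.1 p.2) gf (i, j)).
Qed.

(** Induction on the bound, classical because [P] need not be decidable. *)
Lemma max_of_bounded (P : nat -> Prop) (k b : nat) :
  P k -> (forall n, P n -> n <= b) ->
  exists2 m, P m & forall n, P n -> n <= m.
Proof.
move=> Pk; elim: b => [|b IH] Pb; first by exists k => // n /Pb; lia.
case: (classic (P b.+1)) => [Pb1|nPb1]; first by exists b.+1.
apply: IH => n Pn; have := Pb n Pn; rewrite leq_eqVlt => /orP[/eqP En|//].
by rewrite En in Pn.
Qed.

(** The diagonal vanishes, and the pairs increasing for [enum_rank] mirror the decreasing ones. *)
Lemma even_sum_symmetric (T : finType) (e : rel T) :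
  symmetric e -> irreflexive e -> ~~ odd (\sum_x \sum_y (e x y : nat)).
Proof.
move=> es ei; pose lt (x y : T) := enum_rank x < enum_rank y.
have split_e x y : e x y = e x y && lt x y + e y x && lt y x :> nat.
  rewrite (es y x) /lt; case: (ltngtP (enum_rank x) (enum_rank y)) => [||/ord_inj].
  - by rewrite andbT andbF addn0.
  - by rewrite andbT andbF.
  - by move/enum_rank_inj=> ->; rewrite ei.
under eq_bigr => x _ do
  (under eq_bigr => y _ do rewrite split_e; rewrite big_split /=).
rewrite big_split /= [X in _ + X]exchange_big /= addnn.
by rewrite odd_double.
Qed.

Lemma amgm4 (a m : nat) : 4 * m * a <= 4 * a ^ 2 + m ^ 2.
Proof. by have [+ _] := nat_Cauchy (2 * a) m; rewrite expnMn; lia. Qed.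

(** * Double counting with closed neighbourhoods *)

Section Graph.
Variables (T : finType) (G : sgraph T).

Local Notation N := (closed_nbhd G).

Lemma closed_nbhdE x y : (y \in N x) = (y == x) || G x y.
Proof. by rewrite !inE. Qed.

Lemma closed_nbhd_sym x y : (y \in N x) = (x \in N y).
Proof. by rewrite !closed_nbhdE eq_sym adj_sym. Qed.

Lemma closed_nbhd_refl x : x \in N x.
Proof. by rewrite closed_nbhdE eqxx. Qed.

(** Handshake lemma: [#|N x|] is one more than the degree of [x]. *)
Lemma odd_sum_closed_nbhd : odd (\sum_x #|N x|) = odd #|T|.
Proof.
have E x : #|N x| = 1 + \sum_y (G x y : nat).
  rewrite cardsU1 inE adj_irr add1n; congr _.+1.
  by rewrite -sum1dep_card big_mkcond; apply: eq_bigr => y _; case: (G x y).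
rewrite (eq_bigr _ (fun x _ => E x)) big_split /= sum1_card oddD.
by rewrite (negbTE (even_sum_symmetric (adj_sym G) (adj_irr G))) addbF.
Qed.

Lemma sum_closed_nbhdI x :
  \sum_y #|N x :&: N y| = \sum_(z in N x) #|N z|.
Proof.
have E y : #|N x :&: N y| = \sum_(z in N x) (z \in N y : nat).
  by rewrite -sum1_card big_mkcond [RHS]big_mkcond /=; apply: eq_bigr => z _;
     rewrite inE; case: (z \in N x); case: (z \in N y).
rewrite (eq_bigr _ (fun y _ => E y)) exchange_big /=.
apply: eq_bigr => z _; rewrite -sum1_card [RHS]big_mkcond /=.
by apply: eq_bigr => y _; rewrite (closed_nbhd_sym y z); case: (y \in N z).
Qed.

(** By symmetry [z] lies in [#|N z|] closed neighbourhoods, hence in the intersections of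
    [#|N z| ^ 2] ordered pairs. *)
Lemma sum2_closed_nbhdI :
  \sum_x \sum_y #|N x :&: N y| = \sum_x #|N x| ^ 2.
Proof.
under eq_bigr => x _ do rewrite sum_closed_nbhdI big_mkcond.
rewrite exchange_big; apply: eq_bigr => z _ /=.
rewrite -mulnn -sum_nat_const [RHS]big_mkcond.
by apply: eq_bigr => x _; rewrite (closed_nbhd_sym x z).
Qed.

End Graph.

(** * Closed neighbourhoods as a code *)

Section Code.
Variables (n k : nat) (G : sgraph 'I_n).
Hypotheses (kn : k <= n) (GrG : Gr k G).

Local Notation N := (closed_nbhd G).

(** Otherwise some [k]-set would be disjoint from [N x]. *)
Lemma Gr_card_closed_nbhd x : n < #|N x| + k.
Proof.
rewrite ltnNge; apply/negP => H.
have : k <= #|~: N x| by have := cardsC (N x); rewrite card_ord; lia.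
case/subset_of_card => C sC cC; have [/(_ x) + _] := GrG cC.
by rewrite setI_eq0 disjoint_sym disjoints_subset sC.
Qed.

(** Otherwise some [k]-set would avoid the symmetric difference of [N x] and [N y] and fail to
    separate [x] from [y]. *)
Lemma Gr_card_closed_nbhdI x y :
  x != y -> n < #|N x| + #|N y| - 2 * #|N x :&: N y| + k.
Proof.
move=> xy; rewrite ltnNge; apply/negP => H.
pose E := (N x :\: N y) :|: (N y :\: N x).
have cE : #|E| = #|N x| + #|N y| - 2 * #|N x :&: N y|.
  have dE : #|(N x :\: N y) :&: (N y :\: N x)| = 0.
    by apply/eqP; rewrite cards_eq0; apply/eqP/setP => z; rewrite !inE;
       case: (_ || _); case: (_ || _).
  have := cardsID (N y) (N x); have := cardsID (N x) (N y).
  rewrite /E cardsU dE (setIC (N y)); lia.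
have : k <= #|~: E| by have := cardsC E; rewrite card_ord; lia.
case/subset_of_card => C sC cC; have [_ /(_ x y xy) /eqP[]] := GrG cC.
apply/setP => z; rewrite !in_setI; case: (boolP (z \in C)); rewrite ?andbF //.
move=> /(subsetP sC); rewrite in_setC in_setU !in_setD.
by case: (z \in N x); case: (z \in N y).
Qed.

(** The last term turns the inequality into an equality for [x = y], so that it
    can be summed over all pairs. *)
Lemma Gr_dist x y :
  2 * #|N x :&: N y| + (n.+1 - k) <= #|N x| + #|N y| + (x == y) * (n.+1 - k).
Proof.
have [->|xy] := eqVneq x y; first by rewrite setIid; lia.
have := Gr_card_closed_nbhdI xy; lia.
Qed.

End Code.

(** * The averaging bound and its equality case *)

Lemma sum_diag (T : finType) (d : nat) :
  \sum_(x : T) \sum_(y : T) (x == y) * d = #|T| * d.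
Proof.
rewrite -sum_nat_const; apply: eq_bigr => x _.
rewrite (bigD1 x) //= eqxx mul1n big1 ?addn0 // => y.
by rewrite eq_sym => /negbTE ->.
Qed.

Lemma sum2D (T : finType) (a : T -> nat) :
  \sum_x \sum_y (a x + a y) = 2 * #|T| * \sum_x a x.
Proof.
under eq_bigr => x _ do rewrite big_split /= sum_nat_const.
by rewrite big_split /= sum_nat_const -big_distrr -mulnA mul2n -addnn.
Qed.

Section Plotkin.
Variables (n k : nat) (G : sgraph 'I_n).
Hypotheses (k0 : 0 < k) (kn : k <= n) (GrG : Gr k G).

Local Notation N := (closed_nbhd G).
Local Notation A := (\sum_x #|N x|).
Local Notation Q := (\sum_x #|N x| ^ 2).
Local Notation d := (n.+1 - k).

Lemma Gr_sum_dist : 2 * Q + n * (n * d) <= 2 * n * A + n * d.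
Proof.
have := leq_sum2 (Gr_dist kn GrG).
under eq_bigr => x _ do rewrite big_split /= -big_distrr sum_nat_const /=.
rewrite big_split /= -big_distrr /= sum2_closed_nbhdI sum_nat_const.
under [X in _ <= X -> _]eq_bigr => x _ do rewrite big_split /=.
by rewrite big_split /= sum2D sum_diag card_ord.
Qed.

Lemma Gr_sum_card : n * d <= A.
Proof.
rewrite -[X in X * _]card_ord -sum_nat_const; apply: leq_sum => x _.
have := Gr_card_closed_nbhd kn GrG x; lia.
Qed.

Lemma Gr_leq_2k_sub1 : n <= 2 * k - 1.
Proof.
(* Sum of the squares of [2 * #|N x| - n.+1], expanded. *)
have H : 4 * n.+1 * A <= 4 * Q + n * n.+1 ^ 2.
  rewrite -[X in _ + X * _]card_ord -sum_nat_const !big_distrr -big_split /=.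
  by apply: leq_sum => x _; apply: amgm4.
(* Eliminating [Q] leaves a term [4 * A], which [Gr_sum_card] bounds below by [4 * n * d]. *)
have : n * (2 * n.+1 * d) <= n * n.+1 ^ 2.
  by move: Gr_sum_dist Gr_sum_card H; move: A Q d (n.+1 ^ 2); clear; lia.
rewrite leq_pmul2l; last lia.
rewrite mulnC mulnA -mulnn leq_pmul2r //; lia.
Qed.

Lemma Gr_neq_2k_sub1 : 1 < k -> n <> 2 * k - 1.
Proof.
move=> k1 En; have Ed : d = k by lia.
have H1 := Gr_sum_dist; have H2 := Gr_sum_card; rewrite Ed in H1 H2.
(* The squares are now centred at [k], which is half of [n.+1]. *)
have H : 2 * k * A <= Q + n * k ^ 2.
  rewrite -[X in _ + X * _]card_ord -sum_nat_const !big_distrr -big_split /=.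
  by apply: leq_sum => x _; rewrite -mulnA [k * _]mulnC (nat_Cauchy _ k).
have AE : A = n * k by apply/eqP; rewrite eqn_leq H2 andbT; nia.
have a_eq x : k = #|N x|.
  apply: (eq_of_leq_sum (f := fun=> k) (g := fun x => #|N x|)) => [y|].
    by have := Gr_card_closed_nbhd kn GrG y; lia.
  by rewrite sum_nat_const card_ord AE.
have QE : Q = n * k ^ 2.
  by under eq_bigr => x _ do rewrite -a_eq; rewrite sum_nat_const card_ord.
have c_eq x y : 2 * #|N x :&: N y| + k = #|N x| + #|N y| + (x == y) * k.
  apply: (eq_of_leq_sum2 (f := fun x y => 2 * #|N x :&: N y| + k)
    (g := fun x y => #|N x| + #|N y| + (x == y) * k)) => [u v|].
    by have := Gr_dist kn GrG u v; rewrite Ed.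
  under eq_bigr => u _ do rewrite big_split /=.
  under [X in _ <= X]eq_bigr => u _ do
    rewrite big_split /= -big_distrr sum_nat_const /=.
  rewrite !big_split /= sum2D sum_diag -big_distrr sum2_closed_nbhdI.
  rewrite !sum_nat_const !card_ord /= AE QE.
  have : n * k * n.+1 = n * k * (2 * k) by congr (_ * _); lia.
  rewrite -!mulnn; lia.
(* For distinct [x] and [y], [c_eq] reads [2 * #|N x :&: N y| = k]; such a pair exists because
   [k > 1]. *)
have even_k : ~~ odd k.
  have n0 : 0 < n by lia.
  have n1 : 1 < n by lia.
  have := c_eq (Ordinal n0) (Ordinal n1); rewrite -!a_eq.
  have -> : (Ordinal n0 == Ordinal n1) = false by [].
  lia.
(* [A = n * k] is even, but [n = 2 * k - 1] is odd. *)
have := odd_sum_closed_nbhd G; rewrite AE card_ord oddM (negbTE even_k) andbF.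
lia.
Qed.

End Plotkin.

(** * The case of ten vertices and [k = 6] *)

Section Ten.
Variable G : sgraph 'I_10.
Hypothesis GrG : Gr 6 G.

Local Notation N := (closed_nbhd G).
(** [S] turns out to consist of the vertices whose closed neighbourhoods have size 6. *)
Let p (x : 'I_10) := ~~ odd #|N x|.
Let S := [set x | p x].
Let q := #|S|.

Let inS x : (x \in S) = p x.
Proof. by rewrite inE. Qed.

Lemma Gr10_card x : 5 + p x <= #|N x|.
Proof. by have := Gr_card_closed_nbhd (isT : 6 <= 10) GrG x; rewrite /p; lia. Qed.

(** For [x != y] the distance is at least 5 and has the parity of [#|N x| + #|N y|], so 5 improves
    to 6 when the two sizes have equal parity. *)
Lemma Gr10_dist x y :
  2 * #|N x :&: N y| + (5 + (p x == p y)) <= #|N x| + #|N y| + (x == y) * 6.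
Proof.
have [->|xy] := eqVneq x y; first by rewrite setIid eqxx; lia.
have := Gr_dist (isT : 6 <= 10) GrG x y; rewrite (negbTE xy) /p; lia.
Qed.

Let sum_p : \sum_x (p x : nat) = q.
Proof.
by rewrite /q -sum1dep_card [RHS]big_mkcond /=; apply: eq_bigr => x _; case: (p x).
Qed.

Let sum_pN : \sum_x (~~ p x : nat) = 10 - q.
Proof.
have : \sum_x ((p x : nat) + ~~ p x) = 10.
  under eq_bigr => x _ do have -> : (p x : nat) + ~~ p x = 1 by case: (p x).
  by rewrite sum1_card card_ord.
rewrite big_split /= sum_p; lia.
Qed.

Let sum_eqp x : \sum_y (p x == p y : nat) = if p x then q else 10 - q.
Proof.
by case: (p x); [rewrite -sum_p | rewrite -sum_pN];
   apply: eq_bigr => y _; case: (p y).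
Qed.

Let q_le : q <= 10.
Proof. by rewrite /q (leq_trans (max_card _)) ?card_ord. Qed.

Let sum2_eqp : \sum_x \sum_y (p x == p y : nat) = q ^ 2 + (10 - q) ^ 2.
Proof.
under eq_bigr => x _ do rewrite sum_eqp.
have E x : (if p x then q else 10 - q) = p x * q + ~~ p x * (10 - q).
  by case: (p x); lia.
by rewrite (eq_bigr _ (fun x _ => E x)) big_split /= -!big_distrl /= sum_p sum_pN.
Qed.

Let sum_lhs :
  \sum_x \sum_y (2 * #|N x :&: N y| + (5 + (p x == p y))) =
  2 * \sum_x #|N x| ^ 2 + (500 + (q ^ 2 + (10 - q) ^ 2)).
Proof.
under eq_bigr => x _ do
  rewrite big_split /= -big_distrr big_split /= sum_nat_const card_ord.
rewrite big_split /= -big_distrr sum2_closed_nbhdI big_split /= sum2_eqp.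
by rewrite sum_nat_const card_ord.
Qed.

Let sum_rhs :
  \sum_x \sum_y (#|N x| + #|N y| + (x == y) * 6) = 20 * \sum_x #|N x| + 60.
Proof.
under eq_bigr => x _ do rewrite big_split /=.
by rewrite big_split /= sum2D sum_diag card_ord.
Qed.

Let sum_5p : \sum_x (5 + p x) = 50 + q.
Proof. by rewrite big_split /= sum_p sum_nat_const card_ord. Qed.

Lemma Gr10_tight : q = 4 /\ \sum_x #|N x| = 54.
Proof.
have H1 := leq_sum2 Gr10_dist; rewrite sum_lhs sum_rhs in H1.
have H2 : 50 + q <= \sum_x #|N x|.
  by rewrite -sum_5p; apply: leq_sum => x _; apply: Gr10_card.
have H3 : 11 * \sum_x #|N x| <= \sum_x #|N x| ^ 2 + 300.
  (* [(a - 5) (a - 6) >= 0] *)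
  rewrite -[300]/(10 * 30) -[X in _ + X * _](card_ord 10) -sum_nat_const.
  rewrite big_distrr -big_split /=; apply: leq_sum => x _.
  by move: #|_| => a; rewrite -mulnn; case: (ltnP a 6) => ?; nia.
have H4 := odd_sum_closed_nbhd G; rewrite card_ord in H4.
(* [H1]-[H3] give [(q - 4) (q - 5) <= 0]; by the handshake lemma [H4], [q <> 5]. *)
move: (\sum_x #|N x|) (\sum_x _ ^ 2) H1 H2 H3 H4 q_le => A Q.
by move: q; do 11?[case=> [|]]; lia.
Qed.

Lemma Gr10_cardE x : #|N x| = 5 + p x.
Proof.
have [q4 A54] := Gr10_tight; symmetry; move: x.
by apply: eq_of_leq_sum Gr10_card _; rewrite sum_5p A54 q4.
Qed.

Lemma Gr10_distE x y :
  2 * #|N x :&: N y| + (5 + (p x == p y)) = #|N x| + #|N y| + (x == y) * 6.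
Proof.
have [q4 A54] := Gr10_tight; move: x y; apply: eq_of_leq_sum2 Gr10_dist _.
rewrite sum_lhs sum_rhs q4 A54.
(* [294 = 4 * 6 ^ 2 + 6 * 5 ^ 2]. *)
suff -> : \sum_x #|N x| ^ 2 = 294 by [].
have E x : #|N x| ^ 2 = 25 + 11 * p x by rewrite Gr10_cardE; case: (p x).
rewrite (eq_bigr _ (fun x _ => E x)) big_split /= -big_distrr /= sum_p q4.
by rewrite sum_nat_const card_ord.
Qed.

Lemma Gr10_interE x y : #|N x :&: N y| = 2 + (p x || p y) + (x == y) * 3.
Proof.
have := Gr10_distE x y; rewrite !Gr10_cardE.
have [->|_] := eqVneq x y; first by case: (p y); lia.
by case: (p x); case: (p y) => /=; lia.
Qed.

(** The double count of [sum_closed_nbhdI] at [t] reads [10 * 2 + 4 + 3 = 5 * 5 + #|N t :&: S|]. *)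
Lemma Gr10_inter_S t : ~~ p t -> #|N t :&: S| = 2.
Proof.
move=> pt; have [q4 _] := Gr10_tight.
have := sum_closed_nbhdI G t.
under eq_bigr => y _ do rewrite Gr10_interE (negbTE pt) /=.
under [X in _ = X -> _]eq_bigr => z _ do rewrite Gr10_cardE.
rewrite !big_split /= !sum_nat_const sum_p card_ord q4 Gr10_cardE (negbTE pt).
rewrite (bigD1 t) //= eqxx big1 => [|y /negbTE]; last by rewrite eq_sym => ->.
have -> : \sum_(z in N t) (p z : nat) = #|N t :&: S|.
  rewrite -sum1_card big_mkcond [RHS]big_mkcond /=; apply: eq_bigr => z _.
  by rewrite in_setI inS; case: (z \in N t); case: (p z).
by move: #|_ :&: _| => c; lia.
Qed.

Lemma Gr10_false : False.
Proof.
have [q4 _] := Gr10_tight.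
have [t pt] : exists t, ~~ p t.
  apply/existsP; rewrite -negb_forall; apply/negP => /forallP allp.
  have : S = setT by apply/setP => x; rewrite !inE allp.
  by move=> ST; move: q4; rewrite /q ST cardsT card_ord.
have Nt : #|N t :\: S :\ t| = 2.
  have tS : t \in N t :\: S by rewrite in_setD closed_nbhd_refl inS pt.
  have := cardsID S (N t); rewrite Gr10_inter_S // (cardsD1 t (_ :\: _)) tS.
  rewrite Gr10_cardE (negbTE pt); move: #|_ :\ _| => c; lia.
have compl u : u \in N t :\: S :\ t -> ~~ p u /\ N u :&: S = S :\: N t.
  rewrite in_setD1 in_setD inS => /and3P[ut pu uNt]; split=> //.
  have sub : [set t; u] \subset N t :&: N u.
    apply/subsetP => z; rewrite in_set2 in_setI => /orP[]/eqP->.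
      by rewrite closed_nbhd_refl -(closed_nbhd_sym G) uNt.
    by rewrite uNt closed_nbhd_refl.
  (* As [t] and [u] lie outside [S], they have only two common elements; hence no vertex of [S] is
     in both [N t] and [N u]. *)
  have Etu : [set t; u] = N t :&: N u.
    apply/eqP; rewrite eqEcard sub Gr10_interE (negbTE pt) (negbTE pu).
    by rewrite cards2 eq_sym (negbTE ut).
  apply/eqP; rewrite eqEcard Gr10_inter_S //; apply/andP; split.
    apply/subsetP => z; rewrite in_setI in_setD => /andP[zu zS].
    rewrite zS andbT; apply/negP => zt.
    have : z \in [set t; u] by rewrite Etu in_setI zt zu.
    move: zS; rewrite inS in_set2 => pz /orP[]/eqP E.
      by rewrite E (negbTE pt) in pz.
    by rewrite E (negbTE pu) in pz.
  by have := cardsID (N t) S; rewrite setIC Gr10_inter_S // -/q q4;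
     move: #|_ :\: _| => c; lia.
case/cards2P: (introT eqP Nt) => u [v [uv E]].
have [pu Nu] : ~~ p u /\ N u :&: S = S :\: N t by apply: compl; rewrite E in_set2 eqxx.
have [pv Nv] : ~~ p v /\ N v :&: S = S :\: N t.
  by apply: compl; rewrite E in_set2 eqxx orbT.
(* Three common elements, where [Gr10_interE] allows two. *)
have sub : t |: (N u :&: S) \subset N u :&: N v.
  apply/subsetP => z; rewrite in_setU1 => /orP[/eqP->|zS].
    have : (u \in N t :\: S :\ t) && (v \in N t :\: S :\ t).
      by rewrite E !in_set2 !eqxx orbT.
    rewrite !in_setD1 !in_setD in_setI => /andP[/and3P[_ _ +] /and3P[_ _ +]].
    by rewrite (closed_nbhd_sym G t) (closed_nbhd_sym G t v) => -> ->.
  have : z \in N v :&: S by rewrite Nv -Nu.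
  by move: zS; rewrite !in_setI => /andP[-> _] /andP[-> _].
have := subset_leq_card sub.
rewrite Gr10_interE (negbTE pu) (negbTE pv) (negbTE uv) cardsU1 Gr10_inter_S //.
by rewrite in_setI inS (negbTE pt) andbF.
Qed.

End Ten.

(** In the edgeless graph closed neighbourhoods are singletons, and the only [k]-set is the whole
    vertex set. *)
Lemma Gr_nonempty_diag (k : nat) : 0 < k -> Gr_nonempty k k.
Proof.
move=> k0; have sym0 : symmetric (fun _ _ : 'I_k => false) by [].
have irr0 : irreflexive (fun _ _ : 'I_k => false) by [].
exists (SGraph sym0 irr0) => C cC.
have -> : C = setT by apply/eqP; rewrite eqEcard subsetT cardsT card_ord cC /=.
have nbE x : closed_nbhd (SGraph sym0 irr0) x = [set x].
  by apply/setP => y; rewrite !inE orbF.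
split=> [x|x y xy]; rewrite !nbE !setIT.
  by apply/set0Pn; exists x; rewrite inE.
by apply: contraNneq xy => /set1_inj ->.
Qed.

Theorem theorem22 (k : nat) (hk : 6 <= k) :
  exists2 m : nat, is_Xi k m & m <= 3 * k - 9.
Proof.
have bound n : k <= n /\ Gr_nonempty n k -> n <= 3 * k - 9.
  move=> [kn [G GrG]].
  have n2k : n <= 2 * k - 1 by apply: Gr_leq_2k_sub1 GrG; lia.
  have n2k' : n <> 2 * k - 1 by apply: Gr_neq_2k_sub1 GrG _; lia.
  (* [2 * k - 2 <= 3 * k - 9] once [k >= 7]; for [k = 6] only [n = 10] is left above the bound 9. *)
  have [k6|k6] := eqVneq k 6; last by lia.
  have [n10|n10] := eqVneq n 10; last by lia.
  by subst k n; case: (Gr10_false GrG).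
have kk : k <= k /\ Gr_nonempty k k by split; last by apply: Gr_nonempty_diag; lia.
have [m [km Gm] mmax] := max_of_bounded kk bound.
exists m; last exact: bound.
by split=> // n kn Gn; apply: mmax.
Qed.
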